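(* The system $\mathsf{DG}+(\mathsf{KS}_0^{*})^{\mathrm{st}}$ is inconsistent, where $\mathsf{KS}_0^*$ is $(\forall\alpha\le_1 1)(\exists\beta\le_1 1)(\forall m^{0})\big[(\forall k^{0})(\alpha(k,m)=0)\leftrightarrow(\exists n^0)(\beta(n,m)=0)\big]$ (with $\alpha(k,m)$ denoting $\alpha$ applied to a code of the pair $(k,m)$), and $(\mathsf{KS}_0^{*})^{\mathrm{st}}$ is $(\forall^{\mathrm{st}}\alpha\le_1 1)(\exists^{\mathrm{st}}\beta\le_1 1)(\forall^{\mathrm{st}} m^{0})\big[(\forall^{\mathrm{st}} k^{0})(\alpha(k,m)=0)\leftrightarrow(\exists^{\mathrm{st}} n^0)(\beta(n,m)=0)\big]$.
   Context: Finite types: $0$ is a type and if $\rho,\sigma$ are types so is $\rho\to\sigma$; type $1=0\to0$, $2=1\to0$. $\mathsf{E\text{-}HA}^{\omega}$ is Heyting arithmetic in all finite types (intuitionistic logic, Gödel's $T$ constants) with extensionality. Equality $=_0$ is primitive; for $\tau=\tau_1\to\dots\to\tau_k\to0$, $x=_\tau y$ abbreviates $(\forall z_1\dots z_k)(xz_1\dots z_k=_0yz_1\dots z_k)$, and $\le_\tau$ likewise. Extensionality $(\mathsf E_{\rho\to\tau})$: $(\forall\varphi)(\forall x,y)(x=_\rho y\to\varphi(x)=_\tau\varphi(y))$, for all types. Binary sequences: $f\le_1 1$. Strong majorizability (Howard–Bezem): $x\le^*_0 y$ iff $x\le_0 y$; $x\le^*_{\rho\to\sigma}y$ iff for all $u,v$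 with $u\le^*_\rho v$: $xu\le^*_\sigma yv$ and $yu\le^*_\sigma yv$. Monotone: $x\le^*x$; $\tilde\forall,\tilde\exists$ range over monotone objects. The language of $\mathsf{DG}$ adds predicates $\mathrm{st}^\sigma$ (''is standard''); $\forall^{\mathrm{st}},\exists^{\mathrm{st}}$ are the relativised quantifiers, $\tilde\forall^{\mathrm{st}},\tilde\exists^{\mathrm{st}}$ combine both restrictions. Internal = not containing $\mathrm{st}$. $\mathsf{DG}$ is $\mathsf{E\text{-}HA}^\omega$ in the extended language plus: (a) $x=_\sigma y\to(\mathrm{st}(x)\to\mathrm{st}(y))$; (b) $\mathrm{st}(y)\to(x\le^*_\sigma y\to\mathrm{st}(x))$; (c) $\mathrm{st}(t)$ for closed terms $t$; (d) $\mathrm{st}(z)\to(\mathrm{st}(x)\to\mathrm{st}(zx))$; external induction $\Phi(0)\wedge(\forall^{\mathrm{st}}n)(\Phi(n)\to\Phi(n+1))\to(\forall^{\mathrm{st}}n)\Phi(n)$ for any $\Phi$; and for arbitrary $\Phi,\Psi$ and internal $\phi,\psi$: $\mathsf{mAC}^\omega$: $(\tilde\forall^{\mathrm{st}}x)(\tilde\exists^{\mathrm{st}}y)\Phi(x,y)\to(\tilde\exists^{\mathrm{st}}f)(\tilde\forall^{\mathrm{st}}x)(\exists y\le^*f(x))\Phi(x,y)$; $\mathsf R^\omega$: $(\forall x)(\exists^{\mathrm{st}}y)\Phi(x,y)\to(\tilde\exists^{\mathrm{st}}z)(\forall x)(\exists y\le^*z)\Phi(x,y)$; $\mathsf I^\omega$: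 $(\tilde\forall^{\mathrm{st}}z)(\exists x)(\forall y\le^*z)\phi(x,y)\to(\exists x)(\forall^{\mathrm{st}}y)\phi(x,y)$; $\mathsf{IP}^\omega_{\tilde\forall^{\mathrm{st}}}$: $[(\tilde\forall^{\mathrm{st}}x)\phi(x)\to(\tilde\exists^{\mathrm{st}}y)\Psi(y)]\to(\tilde\exists^{\mathrm{st}}z)[(\tilde\forall^{\mathrm{st}}x)\phi(x)\to(\tilde\exists y\le^*z)\Psi(y)]$; $\mathsf M^\omega$: $[(\tilde\forall^{\mathrm{st}}x)\phi(x)\to\psi]\to(\tilde\exists^{\mathrm{st}}y)[(\forall x\le^*y)\phi(x)\to\psi]$; $\mathsf{MAJ}^\omega$: $(\forall^{\mathrm{st}}x)(\exists^{\mathrm{st}}y)(x\le^*y)$. *)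

(* Defs.v *)
From Stdlib Require Import List.
Import ListNotations.

Set Implicit Arguments.

(** Variables are well-scoped, well-typed de Bruijn indices: a context lists
    the types of the free variables, most recently bound first. *)

Inductive ty : Type :=
| o : ty
| arr : ty -> ty -> ty.

Declare Scope ty_scope.
Delimit Scope ty_scope with ty.
Bind Scope ty_scope with ty.
Notation "r --> s" := (arr r s) (at level 55, right associativity) : ty_scope.
Open Scope ty_scope.

Definition ctx := list ty.

Inductive var : ctx -> ty -> Type :=
| vz : forall G r, var (r :: G) r
| vs : forall G r s, var G s -> var (r :: G) s.
Arguments vz {G r}.
Arguments vs {G r s} _.

(** [tPi], [tSigma] and [tRec] are the two combinators and the recursors of
    Goedel's T. *)
Inductive tm (G : ctx) : ty -> Type :=
| tvar : forall r, var G r -> tm G r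
| tapp : forall r s, tm G (r --> s) -> tm G r -> tm G s
| tO : tm G o
| tS : tm G (o --> o)
| tPi : forall r s, tm G (r --> s --> r)
| tSigma : forall r s t, tm G ((r --> s --> t) --> (r --> s) --> r --> t)
| tRec : forall r, tm G (o --> r --> (r --> o --> r) --> r).
Arguments tvar {G r} _.
Arguments tapp {G r s} _ _.
Arguments tO {G}.
Arguments tS {G}.
Arguments tPi {G r s}.
Arguments tSigma {G r s t}.
Arguments tRec {G r}.

Declare Scope tm_scope.
Delimit Scope tm_scope with tm.
Bind Scope tm_scope with tm.
Notation "f @ x" := (tapp f x) (at level 40, left associativity) : tm_scope.
Open Scope tm_scope.

Inductive fm : ctx -> Type :=
| Eq0 : forall G, tm G o -> tm G o -> fm G
| St : forall G r, tm G r -> fm G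
| Bot : forall G, fm G
| And : forall G, fm G -> fm G -> fm G
| Or : forall G, fm G -> fm G -> fm G
| Imp : forall G, fm G -> fm G -> fm G
| All : forall G r, fm (r :: G) -> fm G
| Ex : forall G r, fm (r :: G) -> fm G.
Arguments Bot {G}.
Arguments All {G} r A.
Arguments Ex {G} r A.

Fixpoint internal G (A : fm G) : Prop :=
  match A with
  | Eq0 _ _ => True
  | St _ => False
  | Bot => True
  | And A B | Or A B | Imp A B => internal A /\ internal B
  | All _ A | Ex _ A => internal A
  end.

Definition renaming (G D : ctx) := forall r, var G r -> var D r.
Definition substitution (G D : ctx) := forall r, var G r -> tm D r.

Fixpoint ren_tm G D (f : renaming G D) r (t : tm G r) : tm D r :=
  match t with
  | tvar x => tvar (f _ x)
  | tapp t u => ren_tm f t @ ren_tm f u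
  | tO => tO
  | tS => tS
  | tPi => tPi
  | tSigma => tSigma
  | tRec => tRec
  end.

Fixpoint sub_tm G D (f : substitution G D) r (t : tm G r) : tm D r :=
  match t with
  | tvar x => f _ x
  | tapp t u => sub_tm f t @ sub_tm f u
  | tO => tO
  | tS => tS
  | tPi => tPi
  | tSigma => tSigma
  | tRec => tRec
  end.

Definition scons G D s (t : tm D s) (f : substitution G D) :
    substitution (s :: G) D :=
  fun r x =>
    match x in var G' r' return
      match G' with
      | [] => unit
      | s' :: G'' => tm D s' -> substitution G'' D -> tm D r'
      end
    with
    | vz => fun t _ => t
    | vs y => fun _ f => f _ y
    end t f.

Definition shift G s : renaming G (s :: G) := fun r x => vs x.
Arguments shift {G s} [r] _.

Definition up_ren G D (f : renaming G D) s : renaming (s :: G) (s :: D) :=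
  fun r x =>
    match x in var G' r' return
      match G' with
      | [] => unit
      | s' :: G'' => renaming G'' D -> var (s' :: D) r'
      end
    with
    | vz => fun _ => vz
    | vs y => fun f => vs (f _ y)
    end f.
Arguments up_ren {G D} f {s} [r] _.

Definition up_sub G D (f : substitution G D) s :
    substitution (s :: G) (s :: D) :=
  scons (tvar vz) (fun r x => ren_tm shift (f r x)).
Arguments up_sub {G D} f {s} [r] _.

Fixpoint ren_fm G (A : fm G) : forall D, renaming G D -> fm D :=
  match A in fm G return forall D, renaming G D -> fm D with
  | Eq0 t u => fun D f => Eq0 (ren_tm f t) (ren_tm f u)
  | St t => fun D f => St (ren_tm f t)
  | Bot => fun D f => Bot
  | And A B => fun D f => And (ren_fm A f) (ren_fm B f)
  | Or A B => fun D f => Or (ren_fm A f) (ren_fm B f)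
  | Imp A B => fun D f => Imp (ren_fm A f) (ren_fm B f)
  | All r A => fun D f => All r (ren_fm A (up_ren f))
  | Ex r A => fun D f => Ex r (ren_fm A (up_ren f))
  end.

Fixpoint sub_fm G (A : fm G) : forall D, substitution G D -> fm D :=
  match A in fm G return forall D, substitution G D -> fm D with
  | Eq0 t u => fun D f => Eq0 (sub_tm f t) (sub_tm f u)
  | St t => fun D f => St (sub_tm f t)
  | Bot => fun D f => Bot
  | And A B => fun D f => And (sub_fm A f) (sub_fm B f)
  | Or A B => fun D f => Or (sub_fm A f) (sub_fm B f)
  | Imp A B => fun D f => Imp (sub_fm A f) (sub_fm B f)
  | All r A => fun D f => All r (sub_fm A (up_sub f))
  | Ex r A => fun D f => Ex r (sub_fm A (up_sub f))
  end.

Definition lift_tm G s r (t : tm G r) : tm (s :: G) r := ren_tm shift t.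
Arguments lift_tm {G s r} t.
Definition lift_fm G s (A : fm G) : fm (s :: G) := ren_fm A shift.
Arguments lift_fm {G s} A.

Definition inst G s (A : fm (s :: G)) (t : tm G s) : fm G :=
  sub_fm A (scons t (fun r x => tvar x)).

(** [A(n)] becomes [A(n + 1)], still with [n] free. *)
Definition inst_succ G (A : fm (o :: G)) : fm (o :: G) :=
  sub_fm A (scons (tS @ tvar vz) (fun r x => tvar (vs x))).

Definition from_nil G : renaming [] G :=
  fun r x =>
    match x in var G' r' return
      match G' with [] => var G r' | _ :: _ => unit end
    with
    | vz => tt
    | vs _ => tt
    end.
Arguments from_nil {G} [r] _.

Definition closed_tm G r (t : tm [] r) : tm G r := ren_tm from_nil t.
Arguments closed_tm {G r} t.
Definition closed_fm G (A : fm []) : fm G := ren_fm A from_nil.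
Arguments closed_fm {G} A.

(** Bracket abstraction: [lam t] is the usual combinatory term for
    the function mapping the most recent variable to [t]. *)
Definition tI G r : tm G (r --> r) := tSigma @ tPi @ @tPi G r r.
Arguments tI {G r}.

Definition lam_var G r s (x : var (r :: G) s) : tm G (r --> s) :=
  match x in var G' s' return
    match G' with [] => unit | r' :: G'' => tm G'' (r' --> s') end
  with
  | vz => tI
  | vs y => tPi @ tvar y
  end.

Fixpoint lam G r s (t : tm (r :: G) s) : tm G (r --> s) :=
  match t in tm _ s return tm G (r --> s) with
  | tvar x => lam_var x
  | tapp t u => tSigma @ lam t @ lam u
  | tO => tPi @ tO
  | tS => tPi @ tS
  | tPi => tPi @ tPi
  | tSigma => tPi @ tSigma
  | tRec => tPi @ tRec
  end.

Definition v0 G r0 : tm (r0 :: G) r0 := tvar vz.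
Definition v1 G r0 r1 : tm (r0 :: r1 :: G) r1 := tvar (vs vz).
Definition v2 G r0 r1 r2 : tm (r0 :: r1 :: r2 :: G) r2 := tvar (vs (vs vz)).
Definition v3 G r0 r1 r2 r3 : tm (r0 :: r1 :: r2 :: r3 :: G) r3 :=
  tvar (vs (vs (vs vz))).
Arguments v0 {G r0}.
Arguments v1 {G r0 r1}.
Arguments v2 {G r0 r1 r2}.
Arguments v3 {G r0 r1 r2 r3}.

Definition tPred G (t : tm G o) : tm G o :=
  tRec @ t @ tO @ lam (lam v0).
Definition tPlus G (t u : tm G o) : tm G o :=
  tRec @ u @ t @ lam (lam (tS @ v1)).
Definition tMinus G (t u : tm G o) : tm G o :=
  tRec @ u @ t @ lam (lam (tPred v1)).
(** [0 + 1 + ... + t] *)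
Definition tTri G (t : tm G o) : tm G o :=
  tRec @ t @ tO @ lam (lam (tPlus v1 (tS @ v0))).
(** Cantor's pairing function. *)
Definition tPair G (t u : tm G o) : tm G o := tPlus (tTri (tPlus t u)) u.

(** The constant function [1] of type [o --> o]. *)
Definition tOne1 G : tm G (o --> o) := tPi @ (tS @ tO).
Arguments tOne1 {G}.

Fixpoint EqT (r : ty) : forall G, tm G r -> tm G r -> fm G :=
  match r return forall G, tm G r -> tm G r -> fm G with
  | o => fun G t u => Eq0 t u
  | arr r s => fun G t u => All r (EqT (lift_tm t @ v0) (lift_tm u @ v0))
  end.
Arguments EqT {r G} t u.

Definition Le0 G (t u : tm G o) : fm G := Eq0 (tMinus t u) tO.

Fixpoint LeT (r : ty) : forall G, tm G r -> tm G r -> fm G :=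
  match r return forall G, tm G r -> tm G r -> fm G with
  | o => fun G t u => Le0 t u
  | arr r s => fun G t u => All r (LeT (lift_tm t @ v0) (lift_tm u @ v0))
  end.
Arguments LeT {r G} t u.

(** Strong majorizability, [t <=* u]. *)
Fixpoint Maj (r : ty) : forall G, tm G r -> tm G r -> fm G :=
  match r return forall G, tm G r -> tm G r -> fm G with
  | o => fun G t u => Le0 t u
  | arr r s => fun G t u =>
      All r (All r
        (let t' := lift_tm (lift_tm t) in
         let u' := lift_tm (lift_tm u) in
         Imp (Maj v1 v0)
             (And (Maj (t' @ v1) (u' @ v0)) (Maj (u' @ v1) (u' @ v0)))))
  end.
Arguments Maj {r G} t u.

Definition Mon G r (t : tm G r) : fm G := Maj t t.

Definition Iff G (A B : fm G) : fm G := And (Imp A B) (Imp B A).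

(** Suffixes: [St] for the standard, [M] for the monotone, [B z] for
    the majorized by [z]. *)
Definition AllSt G r (A : fm (r :: G)) : fm G := All r (Imp (St v0) A).
Definition ExSt G r (A : fm (r :: G)) : fm G := Ex r (And (St v0) A).
Definition AllStM G r (A : fm (r :: G)) : fm G :=
  All r (Imp (And (St v0) (Mon v0)) A).
Definition ExStM G r (A : fm (r :: G)) : fm G :=
  Ex r (And (And (St v0) (Mon v0)) A).
Definition AllB G r (z : tm G r) (A : fm (r :: G)) : fm G :=
  All r (Imp (Maj v0 (lift_tm z)) A).
Definition ExB G r (z : tm G r) (A : fm (r :: G)) : fm G :=
  Ex r (And (Maj v0 (lift_tm z)) A).
Definition ExMB G r (z : tm G r) (A : fm (r :: G)) : fm G :=
  Ex r (And (And (Mon v0) (Maj v0 (lift_tm z))) A).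
Arguments AllSt {G} r A.
Arguments ExSt {G} r A.
Arguments AllStM {G} r A.
Arguments ExStM {G} r A.
Arguments AllB {G r} z A.
Arguments ExB {G r} z A.
Arguments ExMB {G r} z A.

(** Weakenings of [A(x)] and [B(x, y)] ([y] most recent) by one fresh variable
    bound just outside of [x]. *)
Definition weak1 G s r (A : fm (r :: G)) : fm (r :: s :: G) :=
  ren_fm A (up_ren shift).
Definition weak2 G s r1 r2 (B : fm (r2 :: r1 :: G)) : fm (r2 :: r1 :: s :: G) :=
  ren_fm B (up_ren (up_ren shift)).
Arguments weak1 {G s r} A.
Arguments weak2 {G s r1 r2} B.

Definition theory := forall G, fm G -> Prop.

Inductive proves (T : theory) : forall G, list (fm G) -> fm G -> Prop :=
| p_ax : forall G (H : list (fm G)) A, T G A -> proves T H A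
| p_hyp : forall G (H : list (fm G)) A, In A H -> proves T H A
| p_botE : forall G (H : list (fm G)) A, proves T H Bot -> proves T H A
| p_andI : forall G (H : list (fm G)) A B,
    proves T H A -> proves T H B -> proves T H (And A B)
| p_andE1 : forall G (H : list (fm G)) A B,
    proves T H (And A B) -> proves T H A
| p_andE2 : forall G (H : list (fm G)) A B,
    proves T H (And A B) -> proves T H B
| p_orI1 : forall G (H : list (fm G)) A B,
    proves T H A -> proves T H (Or A B)
| p_orI2 : forall G (H : list (fm G)) A B,
    proves T H B -> proves T H (Or A B)
| p_orE : forall G (H : list (fm G)) A B C,
    proves T H (Or A B) -> proves T (A :: H) C -> proves T (B :: H) C ->
    proves T H C
| p_impI : forall G (H : list (fm G)) A B,
    proves T (A :: H) B -> proves T H (Imp A B)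
| p_impE : forall G (H : list (fm G)) A B,
    proves T H (Imp A B) -> proves T H A -> proves T H B
| p_allI : forall G (H : list (fm G)) r (A : fm (r :: G)),
    proves T (map lift_fm H) A -> proves T H (All r A)
| p_allE : forall G (H : list (fm G)) r (A : fm (r :: G)) t,
    proves T H (All r A) -> proves T H (inst A t)
| p_exI : forall G (H : list (fm G)) r (A : fm (r :: G)) t,
    proves T H (inst A t) -> proves T H (Ex r A)
| p_exE : forall G (H : list (fm G)) r (A : fm (r :: G)) C,
    proves T H (Ex r A) -> proves T (A :: map lift_fm H) (lift_fm C) ->
    proves T H C.

Definition inconsistent (T : theory) : Prop := proves T [] (@Bot []).

Inductive extend (T : theory) (K : fm []) : theory :=
| ext_old : forall G (A : fm G), T G A -> extend T K A
| ext_new : forall G, extend T K (@closed_fm G K).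

(** Axioms are open schemata; universal closures are derivable by [p_allI]. *)

(** Logic applies to all formulas of the extended language, but the induction
    schema of E-HA^omega is kept to internal formulas: induction for [St] would
    make every number standard, contradicting idealization. *)
Inductive EHAw : theory :=
| ax_refl : forall G (t : tm G o), EHAw (Eq0 t t)
| ax_sym : forall G (t u : tm G o), EHAw (Imp (Eq0 t u) (Eq0 u t))
| ax_trans : forall G (t u w : tm G o),
    EHAw (Imp (Eq0 t u) (Imp (Eq0 u w) (Eq0 t w)))
| ax_S_inj : forall G (t u : tm G o),
    EHAw (Imp (Eq0 (tS @ t) (tS @ u)) (Eq0 t u))
| ax_S_O : forall G (t : tm G o), EHAw (Imp (Eq0 (tS @ t) tO) Bot)
| ax_Pi : forall G r s (t : tm G r) (u : tm G s), EHAw (EqT (tPi @ t @ u) t)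
| ax_Sigma : forall G r s t (x : tm G (r --> s --> t)) (y : tm G (r --> s))
    (z : tm G r), EHAw (EqT (tSigma @ x @ y @ z) (x @ z @ (y @ z)))
| ax_Rec_O : forall G r (x : tm G r) (y : tm G (r --> o --> r)),
    EHAw (EqT (tRec @ tO @ x @ y) x)
| ax_Rec_S : forall G r (n : tm G o) (x : tm G r) (y : tm G (r --> o --> r)),
    EHAw (EqT (tRec @ (tS @ n) @ x @ y) (y @ (tRec @ n @ x @ y) @ n))
| ax_ext : forall G r s (f : tm G (r --> s)) (x y : tm G r),
    EHAw (Imp (EqT x y) (EqT (f @ x) (f @ y)))
| ax_ind : forall G (A : fm (o :: G)), internal A ->
    EHAw (Imp (And (inst A tO) (All o (Imp A (inst_succ A)))) (All o A)).

Inductive DG : theory :=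
| dg_EHAw : forall G (A : fm G), EHAw A -> DG A
| dg_st_eq : forall G r (x y : tm G r),
    DG (Imp (EqT x y) (Imp (St x) (St y)))
| dg_st_maj : forall G r (x y : tm G r),
    DG (Imp (St y) (Imp (Maj x y) (St x)))
| dg_st_closed : forall G r (t : tm [] r), DG (St (@closed_tm G r t))
| dg_st_app : forall G r s (z : tm G (r --> s)) (x : tm G r),
    DG (Imp (St z) (Imp (St x) (St (z @ x))))
| dg_ext_ind : forall G (P : fm (o :: G)),
    DG (Imp (And (inst P tO) (AllSt o (Imp P (inst_succ P)))) (AllSt o P))
| dg_mAC : forall G r s (P : fm (s :: r :: G)),
    DG (Imp (AllStM r (ExStM s P))
            (ExStM (r --> s) (AllStM r (ExB (v1 @ v0) (weak2 P)))))
| dg_R : forall G r s (P : fm (s :: r :: G)),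
    DG (Imp (All r (ExSt s P))
            (ExStM s (All r (ExB v1 (weak2 P)))))
| dg_I : forall G r s (A : fm (s :: r :: G)), internal A ->
    DG (Imp (AllStM s (Ex r (AllB v1 (weak2 A))))
            (Ex r (AllSt s A)))
| dg_IP : forall G r s (A : fm (r :: G)) (P : fm (s :: G)), internal A ->
    DG (Imp (Imp (AllStM r A) (ExStM s P))
            (ExStM s (Imp (AllStM r (weak1 A)) (ExMB v0 (weak1 P)))))
| dg_M : forall G r (A : fm (r :: G)) (B : fm G), internal A -> internal B ->
    DG (Imp (Imp (AllStM r A) B)
            (ExStM r (Imp (AllB v0 (weak1 A)) (lift_fm B))))
| dg_MAJ : forall G r, DG (@AllSt G r (ExSt r (Maj v1 v0))).

(** The bound [f <=_1 1] is the internal formula; only the displayed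
    quantifiers are relativised. *)
Definition KS0st : fm [] :=
  AllSt (o --> o) (Imp (LeT v0 tOne1)
    (ExSt (o --> o) (And (LeT v0 tOne1)
      (AllSt o
        (Iff (AllSt o (Eq0 (v3 @ tPair v0 v1) tO))
             (ExSt o (Eq0 (v2 @ tPair v0 v1) tO))))))).

(* Main.v *)
(** Write [step K c = sg(c - K)]. For every number [K], standard or not, this is
    a binary sequence, hence majorized by the constant [1], hence standard. KS at
    [m = 0] gives [beta] such that "[step K (k, 0) = 0] for all standard [k]" is
    equivalent to "[beta (n, 0) = 0] for some standard [n]". If [step K]
    vanishes on the standard numbers, then the first statement holds, so the
    second one does; by IP the witness [n] can be bounded by some standard [z]
    in advance, and then by M it suffices that [step K] vanishes up to some
    standard [y]. So for every [K] there is a standard [y] such that [y <= K]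
    implies [step K (k, 0) = 0] for all standard [k]. By R such [y] are bounded
    by a standard [z] independent of [K]. Taking [K = z] and [k = z + 1] yields
    [(z + 1, 0) <= z], which is absurd. *)

Require Import Defs.
From Stdlib Require Import List Setoid Morphisms.
Import ListNotations.

Set Implicit Arguments.

(** * Substitution *)

(** Matching on the context in the return type rules out [[]] by computation, so this inversion uses
    no axiom on equality. [P] is rebound there because its type depends on the context. *)
Definition var_case G s (P : forall r, var (s :: G) r -> Prop)
    (Pz : P s vz) (Ps : forall r (y : var G r), P r (vs y)) :
    forall r (x : var (s :: G) r), P r x :=
  fun r x =>
    match x as x' in var G' r' return
      match G' return var G' r' -> Prop with
      | [] => fun _ => True
      | s' :: G'' => fun x' => forall P : forall r, var (s' :: G'') r -> Prop,
          P s' vz -> (forall r (y : var G'' r), P r (vs y)) -> P r' x'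
      end x'
    with
    | vz => fun P Pz _ => Pz
    | vs y => fun P _ Ps => Ps _ y
    end P Pz Ps.

(** The composite is a parameter [h], compared pointwise only, which avoids functional
    extensionality. *)
Lemma sub_ren_tm G D E (g : renaming G D) (f : substitution D E)
    (h : substitution G E) (E0 : forall r x, f r (g r x) = h r x) r
    (t : tm G r) :
  sub_tm f (ren_tm g t) = sub_tm h t.
Proof. induction t; simpl; try reflexivity; congruence. Qed.

Lemma sub_tm_id G r (t : tm G r) : sub_tm (fun r x => tvar x) t = t.
Proof. induction t; simpl; try reflexivity; congruence. Qed.

Lemma sub_sub_tm G D E (f : substitution G D) (g : substitution D E)
    (h : substitution G E) (E0 : forall r x, sub_tm g (f r x) = h r x) r
    (t : tm G r) :
  sub_tm g (sub_tm f t) = sub_tm h t.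
Proof. induction t; simpl; try reflexivity; congruence. Qed.

Lemma inst_lift_tm G s (a : tm G s) r (t : tm G r) :
  sub_tm (scons a (fun r x => tvar x)) (lift_tm t) = t.
Proof.
  unfold lift_tm. rewrite sub_ren_tm with (h := fun r x => tvar x).
  - apply sub_tm_id.
  - reflexivity.
Qed.

Lemma up_sub_lift_tm G D (f : substitution G D) s r (t : tm G r) :
  sub_tm (up_sub f (s := s)) (lift_tm t) = lift_tm (sub_tm f t).
Proof. unfold lift_tm. induction t; simpl; try reflexivity; congruence. Qed.

Lemma up_ren_lift_tm G D (f : renaming G D) s r (t : tm G r) :
  ren_tm (up_ren f (s := s)) (lift_tm t) = lift_tm (ren_tm f t).
Proof. unfold lift_tm. induction t; simpl; try reflexivity; congruence. Qed.

Lemma sub_fm_EqT r G D (f : substitution G D) (t u : tm G r) :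
  sub_fm (EqT t u) f = EqT (sub_tm f t) (sub_tm f u).
Proof.
  revert G D f t u. induction r as [|r _ s IH]; intros; simpl.
  - reflexivity.
  - rewrite IH. simpl. rewrite !up_sub_lift_tm. reflexivity.
Qed.

Lemma ren_fm_EqT r G D (f : renaming G D) (t u : tm G r) :
  ren_fm (EqT t u) f = EqT (ren_tm f t) (ren_tm f u).
Proof.
  revert G D f t u. induction r as [|r _ s IH]; intros; simpl.
  - reflexivity.
  - rewrite IH. simpl. rewrite !up_ren_lift_tm. reflexivity.
Qed.

(** * Equational reasoning *)

Lemma proves_mono (T T' : theory) (TT' : forall G A, T G A -> T' G A) G
    (H : list (fm G)) A :
  proves T H A -> proves T' H A.
Proof.
  induction 1;
    [ apply p_ax | apply p_hyp | apply p_botE | apply p_andI | eapply p_andE1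
    | eapply p_andE2 | apply p_orI1 | apply p_orI2 | eapply p_orE | apply p_impI
    | eapply p_impE | apply p_allI | apply p_allE | eapply p_exI
    | eapply p_exE ]; eauto.
Qed.

Notation "H |- A" := (proves EHAw H A) (at level 70).

Lemma p_mp T G (H : list (fm G)) A B :
  proves T (A :: H) B -> proves T H A -> proves T H B.
Proof. intros P Q. exact (p_impE (p_impI P) Q). Qed.

Lemma EqT_app1 G H r s (f g : tm G (r --> s)) (x : tm G r) :
  H |- EqT f g -> H |- EqT (f @ x) (g @ x).
Proof.
  intros P. apply (p_allE x) in P. unfold inst in P.
  rewrite sub_fm_EqT in P. simpl in P. rewrite !inst_lift_tm in P. exact P.
Qed.

Lemma lift_EqT G s r (t u : tm G r) :
  lift_fm (s := s) (EqT t u) = EqT (lift_tm t) (lift_tm u).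
Proof. apply ren_fm_EqT. Qed.

Lemma EqT_refl r G H (t : tm G r) : H |- EqT t t.
Proof.
  revert G H t. induction r as [|r _ s IH]; intros G H t; simpl.
  - apply p_ax, ax_refl.
  - apply p_allI, IH.
Qed.

Lemma EqT_sym_imp r G H (t u : tm G r) : H |- Imp (EqT t u) (EqT u t).
Proof.
  revert G H t u. induction r as [|r _ s IH]; intros G H t u.
  - apply p_ax, ax_sym.
  - apply p_impI, p_allI. cbn [map]. rewrite lift_EqT.
    eapply p_impE; [apply IH|]. apply EqT_app1, p_hyp. now left.
Qed.

Lemma EqT_trans_imp r G H (t u w : tm G r) :
  H |- Imp (EqT t u) (Imp (EqT u w) (EqT t w)).
Proof.
  revert G H t u w. induction r as [|r _ s IH]; intros G H t u w.
  - apply p_ax, ax_trans.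
  - apply p_impI, p_impI, p_allI. cbn [map]. rewrite !lift_EqT.
    eapply p_impE; [eapply p_impE; [apply (IH _ _ _ (lift_tm u @ v0))|]|];
      apply EqT_app1, p_hyp; [right|]; now left.
Qed.

(** [EqT] computes on the type and would dissolve into [Eq0] or [All]; this wrapper is a stable
    relation for setoid rewriting inside the object theory. *)
Definition eqv G (H : list (fm G)) r (t u : tm G r) := H |- EqT t u.
Arguments eqv {G} H {r} t u.

#[export] Instance eqv_equiv G (H : list (fm G)) r :
  Equivalence (@eqv G H r).
Proof.
  split.
  - intros t. apply EqT_refl.
  - intros t u P. exact (p_impE (EqT_sym_imp _ _ _) P).
  - intros t u w P Q. exact (p_impE (p_impE (EqT_trans_imp _ _ _ _) P) Q).
Qed.

(** Congruence in the argument is the extensionality axiom; congruence in the function is built into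
    [EqT] at arrow types. *)
#[export] Instance tapp_proper G (H : list (fm G)) r s :
  Proper (eqv H ==> eqv H ==> eqv H) (@tapp G r s).
Proof.
  intros f g P x y Q. transitivity (f @ y).
  - exact (p_impE (p_ax _ _ _ (ax_ext f x y)) Q).
  - apply EqT_app1, P.
Qed.

Lemma eqv_Pi G (H : list (fm G)) r s (t : tm G r) (u : tm G s) :
  eqv H (tPi @ t @ u) t.
Proof. apply p_ax, ax_Pi. Qed.

Lemma eqv_Sigma G (H : list (fm G)) r s t (x : tm G (r --> s --> t))
    (y : tm G (r --> s)) z :
  eqv H (tSigma @ x @ y @ z) (x @ z @ (y @ z)).
Proof. apply p_ax, ax_Sigma. Qed.

Lemma eqv_RecO G (H : list (fm G)) r (x : tm G r) y :
  eqv H (tRec @ tO @ x @ y) x.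
Proof. apply p_ax, ax_Rec_O. Qed.

Lemma eqv_RecS G (H : list (fm G)) r (x : tm G r) y n :
  eqv H (tRec @ (tS @ n) @ x @ y) (y @ (tRec @ n @ x @ y) @ n).
Proof. apply p_ax, ax_Rec_S. Qed.

(* The substitution [f] allows for iterated abstractions: [lam] commutes with
   substitution only up to provable equality. *)
Lemma eqv_sub_lam G D (H : list (fm D)) (f : substitution G D) r (b : tm D r)
    s (t : tm (r :: G) s) :
  eqv H (sub_tm f (lam t) @ b) (sub_tm (scons b f) t).
Proof.
  induction t as [s x|s1 s2 t IHt u IHu| | | | |]; simpl; try apply eqv_Pi.
  - revert s x. apply var_case; simpl.
    + unfold tI. now rewrite eqv_Sigma, eqv_Pi.
    + intros. apply eqv_Pi.
  - now rewrite eqv_Sigma, IHt, IHu.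
Qed.

Lemma eqv_lam G (H : list (fm G)) r (b : tm G r) s (t : tm (r :: G) s) :
  eqv H (lam t @ b) (sub_tm (scons b (fun r x => tvar x)) t).
Proof. rewrite <- eqv_sub_lam, sub_tm_id. reflexivity. Qed.

Lemma eqv_lam2 G (H : list (fm G)) r s (a : tm G r) (b : tm G s) u
    (t : tm (s :: r :: G) u) :
  eqv H (lam (lam t) @ a @ b)
    (sub_tm (scons b (scons a (fun r x => tvar x))) t).
Proof. rewrite eqv_lam. apply eqv_sub_lam. Qed.

(** Predecessor, sum, difference, triangular numbers and sign all have this shape, so their
    successor equations are instances of it by conversion. *)
Lemma eqv_rec_lam G (H : list (fm G)) r (n : tm G o) (x : tm G r)
    (t : tm (o :: r :: G) r) :
  eqv H (tRec @ (tS @ n) @ x @ lam (lam t))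
    (sub_tm (scons n (scons (tRec @ n @ x @ lam (lam t))
                        (fun r x => tvar x))) t).
Proof. rewrite eqv_RecS. apply eqv_lam2. Qed.

(** * Arithmetic *)

Definition tSg G (t : tm G o) : tm G o := tRec @ t @ tO @ lam (lam (tS @ tO)).

#[export] Instance tPred_proper G (H : list (fm G)) :
  Proper (eqv H ==> eqv H) (@tPred G).
Proof. intros t u P. unfold tPred. now rewrite P. Qed.

#[export] Instance tPlus_proper G (H : list (fm G)) :
  Proper (eqv H ==> eqv H ==> eqv H) (@tPlus G).
Proof. intros t u P t' u' Q. unfold tPlus. now rewrite P, Q. Qed.

#[export] Instance tMinus_proper G (H : list (fm G)) :
  Proper (eqv H ==> eqv H ==> eqv H) (@tMinus G).
Proof. intros t u P t' u' Q. unfold tMinus. now rewrite P, Q. Qed.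

#[export] Instance tTri_proper G (H : list (fm G)) :
  Proper (eqv H ==> eqv H) (@tTri G).
Proof. intros t u P. unfold tTri. now rewrite P. Qed.

#[export] Instance tSg_proper G (H : list (fm G)) :
  Proper (eqv H ==> eqv H) (@tSg G).
Proof. intros t u P. unfold tSg. now rewrite P. Qed.

Section Equations.
Context (G : ctx) (H : list (fm G)).
Implicit Types t u : tm G o.

Lemma pred_O : eqv H (tPred tO) tO.
Proof. apply eqv_RecO. Qed.

Lemma pred_S t : eqv H (tPred (tS @ t)) t.
Proof. exact (eqv_rec_lam _ _ _ _). Qed.

Lemma plus_O t : eqv H (tPlus t tO) t.
Proof. apply eqv_RecO. Qed.

Lemma plus_S t u : eqv H (tPlus t (tS @ u)) (tS @ tPlus t u).
Proof. exact (eqv_rec_lam _ _ _ _). Qed.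

Lemma minus_O t : eqv H (tMinus t tO) t.
Proof. apply eqv_RecO. Qed.

Lemma minus_S t u : eqv H (tMinus t (tS @ u)) (tPred (tMinus t u)).
Proof. exact (eqv_rec_lam _ _ _ _). Qed.

Lemma tri_S t : eqv H (tTri (tS @ t)) (tPlus (tTri t) (tS @ t)).
Proof. exact (eqv_rec_lam _ _ _ _). Qed.

Lemma sg_O : eqv H (tSg tO) tO.
Proof. apply eqv_RecO. Qed.

Lemma sg_S t : eqv H (tSg (tS @ t)) (tS @ tO).
Proof. exact (eqv_rec_lam _ _ _ _). Qed.

End Equations.

(** * Induction, truncated subtraction and order *)

Lemma p_allE_eqv2 G (H : list (fm G)) r s (a b : tm (s :: r :: G) o) t u :
  H |- All r (All s (Eq0 a b)) ->
  eqv H (sub_tm (scons u (scons t (fun r x => tvar x))) a)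
    (sub_tm (scons u (scons t (fun r x => tvar x))) b).
Proof.
  intros P. apply (p_allE t), (p_allE u) in P. unfold inst in P. simpl in P.
  rewrite !sub_sub_tm with (h := scons u (scons t (fun r x => tvar x))) in P.
  - exact P.
  - apply var_case; [reflexivity|]. apply var_case; [|reflexivity].
    apply inst_lift_tm.
  - apply var_case; [reflexivity|]. apply var_case; [|reflexivity].
    apply inst_lift_tm.
Qed.

Lemma p_ind G (H : list (fm G)) (A : fm (o :: G)) :
  internal A -> H |- inst A tO -> A :: map lift_fm H |- inst_succ A ->
  H |- All o A.
Proof.
  intros I P Q. eapply p_impE; [apply p_ax, ax_ind, I|].
  apply p_andI; [exact P|]. apply p_allI, p_impI, Q.
Qed.

(* Quantifying over [H'] keeps the induction hypothesis out of the list of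
   hypotheses, where [rewrite] would find its left-hand side. *)
Lemma p_ind_eqv G (H : list (fm G)) (a b : tm (o :: G) o)
    (z := scons tO (fun r x => tvar x))
    (n := scons (tS @ v0) (fun r x => tvar (vs x))) :
  eqv H (sub_tm z a) (sub_tm z b) ->
  (forall H', eqv H' a b -> eqv H' (sub_tm n a) (sub_tm n b)) ->
  H |- All o (Eq0 a b).
Proof.
  intros P Q. apply p_ind; [exact I|exact P|].
  apply Q, p_hyp. now left.
Qed.

Ltac hyp n :=
  apply p_hyp;
  let rec go k :=
    lazymatch k with 0 => left; reflexivity | S ?m => right; go m end
  in go n.

Lemma le_O_all G (H : list (fm G)) : H |- All o (Le0 tO v0).
Proof.
  apply p_ind_eqv; [apply minus_O|]. intros H' IH.
  (* Here and below, [change] carries out the substitution and folds the result back into named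
     operations, whose equations can then rewrite. *)
  change (eqv H' (tMinus tO (tS @ v0)) tO).
  now rewrite minus_S, IH, pred_O.
Qed.

Lemma le_O G (H : list (fm G)) t : H |- Le0 tO t.
Proof. exact (p_allE t (le_O_all H)). Qed.

Lemma minus_SS G (H : list (fm G)) t u :
  eqv H (tMinus (tS @ t) (tS @ u)) (tMinus t u).
Proof.
  apply (@p_allE_eqv2 _ _ _ _ (tMinus (tS @ v1) (tS @ v0)) (tMinus v1 v0)).
  apply p_allI, p_ind_eqv; [|intros H' IH].
  - match goal with |- eqv ?H _ _ =>
      change (eqv H (tMinus (tS @ v0) (tS @ tO)) (tMinus v0 tO)) end.
    now rewrite minus_S, !minus_O, pred_S.
  - change (eqv H' (tMinus (tS @ v1) (tS @ (tS @ v0)))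
      (tMinus v1 (tS @ v0))).
    now rewrite minus_S, IH, minus_S.
Qed.

Lemma minus_S_plus G (H : list (fm G)) t u :
  eqv H (tMinus (tS @ tPlus t u) u) (tS @ t).
Proof.
  apply (@p_allE_eqv2 _ _ _ _ (tMinus (tS @ tPlus v1 v0) v0) (tS @ v1)).
  apply p_allI, p_ind_eqv; [|intros H' IH].
  - match goal with |- eqv ?H _ _ =>
      change (eqv H (tMinus (tS @ tPlus v0 tO) tO) (tS @ v0)) end.
    now rewrite minus_O, plus_O.
  - change (eqv H' (tMinus (tS @ tPlus v1 (tS @ v0)) (tS @ v0)) (tS @ v1)).
    now rewrite plus_S, minus_SS.
Qed.

Lemma le_refl_all G (H : list (fm G)) : H |- All o (Le0 v0 v0).
Proof.
  apply p_ind_eqv; [apply minus_O|]. intros H' IH.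
  change (eqv H' (tMinus (tS @ v0) (tS @ v0)) tO).
  now rewrite minus_SS.
Qed.

Lemma le_refl G (H : list (fm G)) t : H |- Le0 t t.
Proof. exact (p_allE t (le_refl_all H)). Qed.

Lemma le_O_inv G (H : list (fm G)) t : H |- Le0 t tO -> eqv H t tO.
Proof. intros P. rewrite <- (minus_O H t). exact P. Qed.

Lemma le_eq_O G (H : list (fm G)) t u : eqv H t tO -> H |- Le0 t u.
Proof.
  intros P. change (eqv H (tMinus t u) tO). rewrite P. apply le_O.
Qed.

Lemma le_SS G (H : list (fm G)) t u :
  H |- Le0 (tS @ t) (tS @ u) <-> H |- Le0 t u.
Proof.
  change (eqv H (tMinus (tS @ t) (tS @ u)) tO <-> eqv H (tMinus t u) tO).
  now rewrite minus_SS.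
Qed.

Lemma S_ne_O G (H : list (fm G)) t : eqv H (tS @ t) tO -> H |- Bot.
Proof. exact (p_impE (p_ax _ _ _ (ax_S_O t))). Qed.

Notation v4 := (tvar (vs (vs (vs (vs vz))))).

(** The middle number is bound first, so that the induction runs on it with the two outer numbers
    generalised. *)
Lemma le_trans_all G (H : list (fm G)) :
  H |- All o (All o (All o
         (Imp (Le0 v1 v2) (Imp (Le0 v2 v0) (Le0 v1 v0))))).
Proof.
  apply p_ind; [repeat split|apply p_allI, p_allI, p_impI, p_impI|].
  - apply le_eq_O, le_O_inv. hyp 1.
  (* The inductions on the outer numbers act as case distinctions. If both are successors, all three
     are stripped and the hypothesis on the middle number applies. *)
  - refine (p_ind (A := All o (Imp (Le0 v1 (tS @ v2))
      (Imp (Le0 (tS @ v2) v0) (Le0 v1 v0)))) _ _ _); [repeat split| |].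
    { apply p_allI, p_impI, p_impI, le_O. }
    refine (p_ind (A := Imp (Le0 (tS @ v1) (tS @ v2))
      (Imp (Le0 (tS @ v2) v0) (Le0 (tS @ v1) v0))) _ _ _); [repeat split| |].
    + apply p_impI, p_impI, p_botE.
      apply (@S_ne_O _ _ v1), le_O_inv. hyp 0.
    + apply p_impI, p_impI, le_SS.
      refine (p_impE (A := Le0 v2 v0) (p_impE (A := Le0 v1 v2) _ _) _);
        [|apply le_SS; hyp 1|apply le_SS; hyp 0].
      refine (p_allE (A := Imp (Le0 v2 v3) (Imp (Le0 v3 v0) (Le0 v2 v0)))
        v0 _).
      refine (p_allE (A := All o (Imp (Le0 v1 v4)
        (Imp (Le0 v4 v0) (Le0 v1 v0)))) v1 _).
      hyp 4.
Qed.

Lemma sg_le_one_all G (H : list (fm G)) : H |- All o (Le0 (tSg v0) (tS @ tO)).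
Proof.
  apply p_ind_eqv; [|intros H' _].
  - change (eqv H (tMinus (tSg tO) (tS @ tO)) tO).
    rewrite sg_O. apply le_O.
  - change (eqv H' (tMinus (tSg (tS @ v0)) (tS @ tO)) tO).
    rewrite sg_S. apply le_refl.
Qed.

(** * Binary step sequences *)

Definition tStep G : tm G (o --> o --> o) := lam (lam (tSg (tMinus v0 v1))).
Arguments tStep {G}.

Lemma step_eq G (H : list (fm G)) t u :
  eqv H (tStep @ t @ u) (tSg (tMinus u t)).
Proof. apply eqv_lam2. Qed.

(** The arguments [u] and [w] may differ because majorization compares two functions at different
    points. *)
Lemma step_le_one G (H : list (fm G)) t u w :
  H |- Le0 (tStep @ t @ u) (tOne1 @ w).
Proof.
  change (eqv H (tMinus (tStep @ t @ u) (tPi @ (tS @ tO) @ w)) tO).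
  rewrite step_eq, eqv_Pi.
  exact (p_allE _ (sg_le_one_all H)).
Qed.

Lemma step_le G (H : list (fm G)) t u :
  H |- Le0 u t -> eqv H (tStep @ t @ u) tO.
Proof.
  intros P. change (eqv H (tMinus u t) tO) in P.
  now rewrite step_eq, P, sg_O.
Qed.

(* Holds because [tPair (S t) 0 = tTri t + t + 1] exceeds [t]. *)
Lemma step_pair G (H : list (fm G)) t :
  eqv H (tStep @ t @ tPair (tS @ t) tO) (tS @ tO).
Proof.
  unfold tPair.
  now rewrite step_eq, !plus_O, tri_S, plus_S, minus_S_plus, sg_S.
Qed.

Lemma step_le_imp G (H : list (fm G)) t u :
  H |- Imp (Le0 u t) (Eq0 (tStep @ t @ u) tO).
Proof. apply p_impI, step_le. hyp 0. Qed.

Lemma step_pair_neq_O G (H : list (fm G)) t :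
  H |- Imp (Eq0 (tStep @ t @ tPair (tS @ t) tO) tO) Bot.
Proof.
  apply p_impI, (@S_ne_O _ _ tO). rewrite <- step_pair. hyp 0.
Qed.

Lemma one_le_one G (H : list (fm G)) t u : H |- Le0 (tOne1 @ t) (tOne1 @ u).
Proof.
  change (eqv H (tMinus (tPi @ (tS @ tO) @ t) (tPi @ (tS @ tO) @ u)) tO).
  rewrite !eqv_Pi. apply le_refl.
Qed.

Lemma step_maj G (H : list (fm G)) t : H |- Maj (tStep @ t) tOne1.
Proof.
  apply p_allI, p_allI, p_impI, p_andI; [apply step_le_one|apply one_le_one].
Qed.

(** * The inconsistency *)

Definition DGKS := extend DG KS0st.

Lemma dgks_EHAw G (H : list (fm G)) A : H |- A -> proves DGKS H A.
Proof. apply proves_mono. intros. now apply ext_old, dg_EHAw. Qed.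

Lemma dgks_DG G (H : list (fm G)) A : DG A -> proves DGKS H A.
Proof. intros. now apply p_ax, ext_old. Qed.

(** * Closure properties of standardness *)

Lemma st_closed G (H : list (fm G)) r (t : tm [] r) :
  proves DGKS H (St (@closed_tm G r t)).
Proof. apply dgks_DG, dg_st_closed. Qed.

Lemma st_app G (H : list (fm G)) r s (f : tm G (r --> s)) t :
  proves DGKS H (St f) -> proves DGKS H (St t) -> proves DGKS H (St (f @ t)).
Proof.
  intros P Q. exact (p_impE (p_impE (dgks_DG _ (dg_st_app f t)) P) Q).
Qed.

(** The step function is presented as an embedded closed term to make it standard; the step
    functions of sum and triangular numbers have this form by conversion. *)
Lemma st_rec G (H : list (fm G)) (n x : tm G o) (f : tm [] (o --> o --> o)) :
  proves DGKS H (St n) -> proves DGKS H (St x) ->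
  proves DGKS H (St (tRec @ n @ x @ closed_tm f)).
Proof.
  intros P Q. apply st_app; [|apply st_closed]. apply st_app; [|exact Q].
  apply st_app; [|exact P]. exact (st_closed _ tRec).
Qed.

Lemma st_plus G (H : list (fm G)) t u :
  proves DGKS H (St t) -> proves DGKS H (St u) ->
  proves DGKS H (St (tPlus t u)).
Proof. intros P Q. exact (st_rec (lam (lam (tS @ v1))) Q P). Qed.

Lemma st_O G (H : list (fm G)) : proves DGKS H (St tO).
Proof. exact (st_closed _ tO). Qed.

Lemma st_S G (H : list (fm G)) t :
  proves DGKS H (St t) -> proves DGKS H (St (tS @ t)).
Proof. apply st_app. exact (st_closed _ tS). Qed.

Lemma st_pair_O G (H : list (fm G)) t :
  proves DGKS H (St t) -> proves DGKS H (St (tPair t tO)).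
Proof.
  intros P. apply st_plus; [|apply st_O].
  refine (st_rec (lam (lam (tPlus v1 (tS @ v0)))) _ (st_O _)).
  apply st_plus; [exact P|apply st_O].
Qed.

(** Here [t] may be nonstandard: standardness is inherited from the majorant, the constant 1. *)
Lemma st_step G (H : list (fm G)) t : proves DGKS H (St (tStep @ t)).
Proof.
  refine (p_impE (p_impE (dgks_DG _ (dg_st_maj _ tOne1)) _) _).
  - exact (st_closed _ tOne1).
  - apply dgks_EHAw, step_maj.
Qed.

Notation v5 := (tvar (vs (vs (vs (vs (vs vz)))))).

Lemma step_bound G (H : list (fm G)) :
  proves DGKS H (All o (ExSt o (Imp (Le0 v0 v1)
    (AllSt o (Eq0 (tStep @ v2 @ tPair v0 tO) tO))))).
Proof.
  apply p_allI.
  (* KS for the step sequence of K gives beta; the context is now beta, K. *)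
  refine (p_exE (A := And (St v0) (And (LeT v0 tOne1) (AllSt o (Iff
    (AllSt o (Eq0 (tStep @ v3 @ tPair v0 v1) tO))
    (ExSt o (Eq0 (v2 @ tPair v0 v1) tO)))))) _ _ _).
  { refine (p_impE (A := LeT (tStep @ v0) tOne1)
      (p_impE (A := St (tStep @ v0)) _ (st_step _ _)) _).
    - refine (p_allE (A := Imp (St v0) (Imp (LeT v0 tOne1)
        (ExSt (o --> o) (And (LeT v0 tOne1) (AllSt o (Iff
          (AllSt o (Eq0 (v3 @ tPair v0 v1) tO))
          (ExSt o (Eq0 (v2 @ tPair v0 v1) tO)))))))) (tStep @ v0) _).
      apply p_ax. exact (ext_new DG KS0st _).
    - apply dgks_EHAw, p_allI, step_le_one. }
  refine (p_mp (A := Iff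
    (AllSt o (Eq0 (tStep @ v2 @ tPair v0 tO) tO))
    (ExSt o (Eq0 (v1 @ tPair v0 tO) tO))) _ _).
  2: { refine (p_impE (p_allE (A := Imp (St v0) (Iff
         (AllSt o (Eq0 (tStep @ v3 @ tPair v0 v1) tO))
         (ExSt o (Eq0 (v2 @ tPair v0 v1) tO)))) tO _) (st_O _)).
       eapply p_andE2, p_andE2. hyp 0. }
  (* IP is applied with vanishing at all standard numbers, not just at codes of pairs, as premise:
     once M cuts it down to numbers up to y, it follows from y <= K. The context becomes z, beta,
     K. *)
  refine (p_exE (A := And (And (St v0) (Mon v0))
    (Imp (AllStM o (Eq0 (tStep @ v3 @ v0) tO))
         (ExMB v0 (Eq0 (v2 @ tPair v0 tO) tO)))) _ _ _).
  { refine (p_impE (dgks_DG _ (dg_IP (Eq0 (tStep @ v2 @ v0) tO)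
      (Eq0 (v1 @ tPair v0 tO) tO) I)) _).
    apply p_impI.
    refine (p_exE (A := And (St v0) (Eq0 (v1 @ tPair v0 tO) tO)) _ _ _).
    - refine (p_impE (p_andE1 _) _); [hyp 1|].
      apply p_allI, p_impI.
      refine (p_impE (p_allE (A := Imp (And (St v0) (Mon v0))
        (Eq0 (tStep @ v3 @ v0) tO)) (tPair v0 tO) _) _); [hyp 1|].
      apply p_andI; [apply st_pair_O; hyp 0|apply dgks_EHAw, le_refl].
    - refine (p_exI (And (And (St v0) (Mon v0))
        (Eq0 (v2 @ tPair v0 tO) tO)) v0 _).
      apply p_andI; [apply p_andI|].
      + eapply p_andE1. hyp 0.
      + apply dgks_EHAw, le_refl.
      + eapply p_andE2. hyp 0. }
  (* The witness is now bounded by z instead of being required standard, so the conclusion is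
     internal and M applies. The context becomes y, z, beta, K. *)
  refine (p_exE (A := And (And (St v0) (Mon v0))
    (Imp (AllB v0 (Eq0 (tStep @ v4 @ v0) tO))
         (ExMB v1 (Eq0 (v3 @ tPair v0 tO) tO)))) _ _ _).
  { refine (p_impE (dgks_DG _ (dg_M (Eq0 (tStep @ v3 @ v0) tO)
      (ExMB v0 (Eq0 (v2 @ tPair v0 tO) tO)) I _)) _); [repeat split|].
    eapply p_andE2. hyp 0. }
  refine (p_exI (And (St v0) (Imp (Le0 v0 v4)
    (AllSt o (Eq0 (tStep @ v5 @ tPair v0 tO) tO)))) v0 _).
  apply p_andI; [eapply p_andE1, p_andE1; hyp 0|]. apply p_impI.
  refine (p_exE (A := And (And (Mon v0) (Maj v0 v2))
    (Eq0 (v3 @ tPair v0 tO) tO)) _ _ _).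
  { refine (p_impE (p_andE2 _) _); [hyp 1|]. apply p_allI, p_impI.
    refine (p_impE (dgks_EHAw (step_le_imp _ v4 v0)) _).
    refine (p_impE (A := Le0 v1 v4) (p_impE (A := Le0 v0 v1) _ _) _);
      [|hyp 0|hyp 1].
    apply dgks_EHAw.
    exact (p_allE v4 (p_allE v0 (p_allE v1 (le_trans_all _)))). }
  (* The converse half of KS turns a standard zero n of beta into vanishing at all standard k; n is
     standard because it is bounded by the standard z. *)
  refine (p_impE (p_andE2 _) _); [hyp 4|].
  refine (p_exI (And (St v0) (Eq0 (v4 @ tPair v0 tO) tO)) v0 _).
  apply p_andI; [|eapply p_andE2; hyp 0].
  refine (p_impE (p_impE (dgks_DG _ (dg_st_maj v0 v2)) _) _).
  - eapply p_andE1, p_andE1. hyp 3.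
  - eapply p_andE2, p_andE1. hyp 0.
Qed.

Theorem theorem3p24 : inconsistent (extend DG KS0st).
Proof.
  refine (p_exE (A := And (And (St v0) (Mon v0)) (All o (ExB v1
    (Imp (Le0 v0 v1) (AllSt o (Eq0 (tStep @ v2 @ tPair v0 tO) tO)))))) _ _ _).
  { exact (p_impE (dgks_DG _ (dg_R _)) (step_bound _)). }
  refine (p_exE (A := And (Maj v0 v1)
    (Imp (Le0 v0 v1) (AllSt o (Eq0 (tStep @ v2 @ tPair v0 tO) tO)))) _ _ _).
  (* With K taken to be the bound z itself, the estimate y <= z from R is exactly the premise y <=
     K, as [Maj] at type 0 is [Le0]. *)
  { refine (p_allE (A := ExB v1
      (Imp (Le0 v0 v1) (AllSt o (Eq0 (tStep @ v2 @ tPair v0 tO) tO)))) v0 _).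
    eapply p_andE2. hyp 0. }
  refine (p_impE (dgks_EHAw (step_pair_neq_O _ v1)) _).
  (* The argument k = z + 1 is standard because z is, while the code of (k, 0) exceeds z. *)
  refine (p_impE (p_allE (A := Imp (St v0)
    (Eq0 (tStep @ v2 @ tPair v0 tO) tO)) (tS @ v1) _) _).
  - refine (p_impE (p_andE2 _) (p_andE1 _)); hyp 0.
  - apply st_S. eapply p_andE1, p_andE1. hyp 1.
Qed.
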